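(* Let $\Gamma=(G,\sigma)$ be a connected signed graph containing at least one cycle, with girth $g$, and let $C_g^\sigma$ be a shortest cycle of $\Gamma$. Then $i_-(\Gamma)\ge \lceil g/2\rceil-1$. Moreover, equality holds if and only if one of the following holds: (1) $\Gamma=C_g^\sigma$ is a cycle, and either $C_g^\sigma$ is balanced with $g\equiv 0,1 \pmod 4$, or $C_g^\sigma$ is unbalanced with $g\equiv 2,3\pmod 4$; (2) $\Gamma$ is switching equivalent to $(K_{n_1,n_2},+)$ (the complete bipartite graph with all edges positive), or $\Gamma$ is a signed complete multipartite graph $K^\sigma_{n_1,n_2,\dots,n_l}$ with $l\ge 3$ parts in which every 3-cycle is unbalanced (negative).
   Context: A signed graph $\Gamma=(G,\sigma)$ is a simple graph $G$ with a sign function $\sigma:E(G)\to\{+,-\}$; $(G,+)$ denotes all edges positive. Its adjacency matrix $A(\Gamma)$ has $(u,v)$-entry $\sigma(uv)$ if $uv\in E(G)$ and $0$ otherwise; $i_+(\Gamma)$, $i_-(\Gamma)$, $\eta(\Gamma)$ are the numbers of positive, negative, zero eigenvalues of $A(\Gamma)$. The sign of a cycle is the product of the signs of its edges; a cycle is positive (balanced) if its sign is $+$ and negative (unbalanced) otherwise; a signed graph is balanced if all its cycles are positive. Switching by a function $\theta:V\to\{+,-\}$ replaces $\sigma(xy)$ by $\theta(x)\sigma(xy)\theta(y)$; two signed graphs are switching equivalent if one is obtained from the other by switching (switching preserves inertia indices and balance of cycles). The girth $g$ is the length of a shortest cycle. $K_{n_1,\dots,n_l}$ denotes the complete multipartite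 graph with parts of sizes $n_1,\dots,n_l$. *)

(* Defs.v *)
From mathcomp Require Import all_boot all_order all_algebra.
From mathcomp Require Import algC.
Set Implicit Arguments. Unset Strict Implicit. Unset Printing Implicit Defensive.
Import Order.TTheory GRing.Theory Num.Theory.
Local Open Scope ring_scope.

(* A signed graph on vertex set 'I_n: an adjacency relation [adj] (assumed
   symmetric and irreflexive in the theorem) and a sign function [sigma]
   (sigma u v = true means the edge uv is negative; assumed symmetric). *)

Definition sadj_mx (n : nat) (adj : rel 'I_n) (sigma : 'I_n -> 'I_n -> bool)
  : 'M[algC]_n :=
  \matrix_(i, j) (if adj i j then (if sigma i j then -1 else 1) else 0).

Definition spectrum (n : nat) (A : 'M[algC]_n) : seq algC :=
  sval (closed_field_poly_normal (char_poly A)).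

Definition neg_index (n : nat) (A : 'M[algC]_n) : nat :=
  count (fun z => z < 0) (spectrum A).

Definition connected_graph (n : nat) (adj : rel 'I_n) : Prop :=
  forall u v, connect adj u v.

Definition is_cycle (n : nat) (adj : rel 'I_n) (c : seq 'I_n) : bool :=
  ucycleb adj c && (3 <= size c)%N.

Definition is_girth (n : nat) (adj : rel 'I_n) (g : nat) : Prop :=
  (exists c, is_cycle adj c /\ size c = g) /\
  (forall c, is_cycle adj c -> (g <= size c)%N).

(* a cycle is negative (unbalanced) iff it has an odd number of negative
   edges, i.e. the product of its edge signs is - *)
Definition cycle_negative (n : nat) (sigma : 'I_n -> 'I_n -> bool)
  (c : seq 'I_n) : bool :=
  odd (count (fun p => sigma p.1 p.2) (zip c (rot 1 c))).

Definition graph_is_cycle (n : nat) (adj : rel 'I_n) (c : seq 'I_n) : Prop :=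
  (forall x, x \in c) /\
  (forall u v, adj u v -> (v == next c u) || (u == next c v)).

Definition complete_multipartite (n : nat) (adj : rel 'I_n) (l : nat) : Prop :=
  exists f : 'I_n -> 'I_l,
    (forall i : 'I_l, exists x, f x = i) /\
    (forall u v, adj u v = (f u != f v)).

Definition switching_equiv (n : nat) (adj : rel 'I_n)
  (sigma1 sigma2 : 'I_n -> 'I_n -> bool) : Prop :=
  exists theta : 'I_n -> bool,
    forall u v, adj u v -> sigma2 u v = (sigma1 u v (+) theta u (+) theta v).

(* Main.v *)
Require Import Defs.
From HB Require Import structures.
From mathcomp Require Import all_boot all_order all_algebra.
From mathcomp Require Import algC ring zify.
Import Order.TTheory GRing.Theory Num.Theory.
Set Implicit Arguments. Unset Strict Implicit. Unset Printing Implicit Defensive.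

(** The negative index of a real symmetric matrix is the largest dimension of a
    subspace on which its quadratic form is negative definite, and the smallest
    number of linear constraints that make the form nonnegative. Vertices
    [x_i], [y_i] such that the [x_i] are pairwise nonadjacent and the matrix
    [A(x_i, y_j)] is triangular with nonzero diagonal span a hyperbolic space,
    so each pair contributes a negative eigenvalue. Alternate vertices of a
    shortest cycle give the lower bound. If [g >= 5], a vertex outside the cycle
    and adjacent to it has a single neighbour there and yields one more pair, so
    equality forces the graph to be a cycle. After switching, a cycle has edge
    weights [(-1)^i] except for its closing edge, and its form is a sum of terms
    [2 Re (conj x_{2i} (x_{2i+1} - x_{2i-1}))], from which the dependence of the
    negative index on the sign of the cycle is read off. If [g <= 4], the bound
    is [1]; an edge [uv] and a vertex [w] adjacent to neither [u] nor [v] would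
    give two pairs, so nonadjacency is transitive, and the good sign of triangles
    (or of 4-cycles) determines the signature up to switching. Conversely the
    form of [-(J - J_parts)] is nonnegative on the hyperplane of zero sum. *)

(** * Shortest cycles: chords and ears *)

Definition shortest_cycle (n : nat) (adj : rel 'I_n) (c : seq 'I_n) : Prop :=
  is_cycle adj c /\ forall c', is_cycle adj c' -> size c <= size c'.

Section Cycle.
Variables (n : nat) (adj : rel 'I_n).
Hypotheses (adjC : symmetric adj) (adjI : irreflexive adj).
Implicit Types c : seq 'I_n.

Lemma is_cycleP x0 c : reflect
  [/\ 3 <= size c, uniq c, adj (nth x0 c (size c).-1) (nth x0 c 0)
    & forall i, i.+1 < size c -> adj (nth x0 c i) (nth x0 c i.+1)]
  (is_cycle adj c).
Proof.
rewrite /is_cycle /ucycleb; case: c => [|x p].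
  by rewrite andbF; constructor; case.
rewrite /cycle rcons_path (last_nth x0) andbC.
apply: (iffP idP) => [/andP[s3 /andP[/andP[/(pathP x0) pp lx] U]]|[s3 U lx pp]].
  by split=> // i; apply: pp.
by rewrite s3 U /= andbT; apply/andP; split=> //; apply/(pathP x0) => i; apply: pp.
Qed.

Lemma is_cycle_mkseq (v : nat -> 'I_n) k :
  2 <= k -> (forall i, i < k -> adj (v i) (v i.+1)) -> adj (v k) (v 0) ->
  {in [pred i | i <= k] &, injective v} -> is_cycle adj (mkseq v k.+1).
Proof.
move=> k2 adjv adjk vI; apply/(is_cycleP (v 0)); rewrite size_mkseq; split=> //.
- rewrite map_inj_in_uniq ?iota_uniq // => i j.
  by rewrite !mem_iota /= add0n !ltnS => ik jk; apply: vI.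
- by rewrite !nth_mkseq.
by move=> i ik; rewrite !nth_mkseq ?adjv //; lia.
Qed.

Lemma shortest_cycle_rot k c :
  shortest_cycle adj c -> shortest_cycle adj (rot k c).
Proof.
case=> cyc min; split=> [|c']; last by rewrite size_rot; apply: min.
by move: cyc; rewrite /is_cycle size_rot /ucycleb rot_cycle rot_uniq.
Qed.

(** An edge from [i] to [j] with [i + 1 < j] closes the arc between them into a cycle of length
    [j - i + 1], which is too short unless the arc is all of [c]. *)
Lemma shortest_cycle_chordless x0 c i j : shortest_cycle adj c ->
  i < j < size c ->
  adj (nth x0 c i) (nth x0 c j) = (j == i.+1) || (i == 0) && (j == (size c).-1).
Proof.
move=> [/(is_cycleP x0)[s3 U lx pp] min] /andP[ij jc].
apply/idP/idP => [aij|/orP[/eqP ji|/andP[/eqP-> /eqP->]]]; last by rewrite adjC.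
- apply: contraLR isT; rewrite negb_or => /andP[j1 ij0].
  have cyc : is_cycle adj (mkseq (fun k => nth x0 c (i + k)) (j - i).+1).
    apply: is_cycle_mkseq => [|k kij||k l /=].
    + lia.
    + by rewrite addnS; apply: pp; lia.
    + by rewrite subnKC ?addn0 1?adjC //; lia.
    + rewrite !inE => kij lij /eqP; rewrite nth_uniq // ?eqn_add2l; first (by move/eqP);
      apply: leq_ltn_trans jc; lia.
  by have := min _ cyc; rewrite size_mkseq; lia.
by rewrite ji; apply: pp; lia.
Qed.

Lemma shortest_cycle_ear x0 c w j : shortest_cycle adj c -> w \notin c ->
  0 < j < size c -> adj w (nth x0 c 0) -> adj w (nth x0 c j) -> size c <= j.+2.
Proof.
move=> [/(is_cycleP x0)[s3 U lx pp] min] wc /andP[j0 jc] w0 wj.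
pose v k := if k is k'.+1 then nth x0 c k' else w.
have cyc : is_cycle adj (mkseq v j.+2).
  apply: is_cycle_mkseq => [|[|k] //= kij||[|k] [|l] //=].
  - lia.
  - by apply: pp; lia.
  - by rewrite adjC.
  - by rewrite !inE => _ lj e; case/negP: wc; rewrite e mem_nth // (leq_ltn_trans _ jc).
  - by rewrite !inE => lj _ e; case/negP: wc; rewrite -e mem_nth // (leq_ltn_trans _ jc).
  - by rewrite !inE => kij lij /eqP; rewrite nth_uniq //; first (by move/eqP->);
      apply: leq_ltn_trans jc; lia.
by have := min _ cyc; rewrite size_mkseq; lia.
Qed.

(** Two neighbours of [w] cut [c] into two arcs, and each arc closes through [w] with two extra
    edges. Adding the two bounds gives [2 g <= g + 4], against [g >= 5]. *)
Lemma shortest_cycle_ear_unique x0 c w j : shortest_cycle adj c ->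
  5 <= size c -> w \notin c -> adj w (nth x0 c 0) -> j < size c ->
  adj w (nth x0 c j) -> j = 0.
Proof.
move=> sc c5 wc w0 jc wj; case: j => // j in jc wj *.
have h1 := shortest_cycle_ear sc wc _ w0 wj.
have sc' := shortest_cycle_rot j.+1 sc.
have wc' : w \notin rot j.+1 c by rewrite mem_rot.
have h2 := @shortest_cycle_ear x0 _ w (size c - j.+1) sc' wc'.
rewrite size_rot /rot !nth_cat !size_drop !nth_drop ltnn subnn addn0 in h2.
rewrite subn_gt0 jc nth_take // in h2.
have := h1 jc; have := h2 _ wj w0; lia.
Qed.

Lemma next_shortest_cycle x0 c i : shortest_cycle adj c -> i < size c ->
  next c (nth x0 c i) = nth x0 c (if i.+1 == size c then 0 else i.+1).
Proof.
case=> /(is_cycleP x0)[s3 U _ _] _ ic; rewrite next_nth mem_nth //.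
case: c => // y p in s3 U ic *; rewrite index_uniq //=.
rewrite eqSS; case: eqP => [->|ne]; first by rewrite nth_default.
by rewrite (set_nth_default x0) //; move: ic => /=; lia.
Qed.

Lemma graph_is_cycle_shortest c : shortest_cycle adj c ->
  (forall x, x \in c) -> graph_is_cycle adj c.
Proof.
move=> sc all_c; split=> // u v.
have key i j : i < j < size c -> adj (nth u c i) (nth u c j) ->
    (nth u c j == next c (nth u c i)) || (nth u c i == next c (nth u c j)).
  move=> ij; rewrite (shortest_cycle_chordless _ sc) //.
  rewrite !next_shortest_cycle //; try lia.
  case/orP => [/eqP ji|/andP[/eqP i0 /eqP jc]].
    by rewrite -ji ifF ?eqxx //; lia.
  by rewrite i0 jc prednK ?eqxx ?orbT //; lia.
have [i ic <-] := nthP u (all_c u); have [j jc <-] := nthP u (all_c v).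
case: (ltngtP i j) => [ij|ji|->]; last by rewrite adjI.
- by apply: key; rewrite ij jc.
- by rewrite adjC orbC; apply: key; rewrite ji ic.
Qed.

End Cycle.

Local Open Scope ring_scope.
Local Open Scope sesquilinear_scope.

(** * Negative index and quadratic form of a real symmetric matrix *)

Definition symreal (n : nat) (A : 'M[algC]_n) : Prop :=
  (forall i j, A i j = A j i) /\ (forall i j, A i j \is Num.real).

Definition qform (n : nat) (A : 'M[algC]_n) (x : 'rV[algC]_n) : algC :=
  (x *m A *m x ^t*) 0 0.

Lemma qformE n (A : 'M[algC]_n) x :
  qform A x = \sum_j (\sum_i x 0 i * A i j) * (x 0 j)^*.
Proof. by rewrite /qform !mxE; apply: eq_bigr => j _; rewrite !mxE. Qed.

Lemma char_poly_conj n (P D : 'M[algC]_n) : P \in unitmx ->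
  char_poly (invmx P *m D *m P) = char_poly D.
Proof.
move=> uP; rewrite /char_poly /char_poly_mx.
have -> : 'X%:M - map_mx polyC (invmx P *m D *m P) =
  map_mx polyC (invmx P) *m ('X%:M - map_mx polyC D) *m map_mx polyC P.
  rewrite !map_mxM mulmxBr mulmxBl; congr (_ - _).
  by rewrite scalar_mxC -mulmxA -map_mxM mulVmx // map_mx1 mulmx1.
by rewrite !det_mulmx mulrAC -det_mulmx -map_mxM mulVmx // map_mx1 det1 mul1r.
Qed.

(** The list [spectrum] comes from some factorization of the characteristic polynomial. Uniqueness
    of linear factors makes it a permutation of the spectral diagonal, so multiplicities agree. *)
Lemma neg_index_spectral n (A : 'M[algC]_n) : symreal A ->
  exists (P : 'M[algC]_n) (d : 'rV[algC]_n),
    [/\ P *m P ^t* = 1%:M, P ^t* *m P = 1%:M, A = P ^t* *m diag_mx d *m P,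
        (forall i, d 0 i \is Num.real) &
        neg_index A = #|[set i | d 0 i < 0]|].
Proof.
move=> [sA rA].
have hA : A \is hermsymmx.
  apply/is_hermitianmxP; rewrite expr0 scale1r; apply/matrixP => i j.
  by rewrite !mxE sA; apply/esym/CrealP.
have uP := spectral_unitarymx A.
have eA : A = invmx (spectralmx A) *m diag_mx (spectral_diag A) *m spectralmx A.
  by apply/orthomx_spectralP/hermitian_normalmx.
exists (spectralmx A), (spectral_diag A).
have P1 : spectralmx A *m (spectralmx A) ^t* = 1%:M by exact/unitarymxP.
split=> //.
- exact: mulmx1C.
- by rewrite -invmx_unitary.
- by move=> i; move/mxOverP: (hermitian_spectral_diag_real hA); apply.
rewrite /neg_index /spectrum; case: closed_field_poly_normal => s /=.
rewrite (monicP (char_poly_monic A)) scale1r {1}eA char_poly_conj ?spectral_unit //.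
rewrite char_poly_trig ?diag_mx_is_trig //.
rewrite (eq_bigr (fun i => 'X - (spectral_diag A 0 i)%:P)); last first.
  by move=> i _; rewrite mxE eqxx mulr1n.
rewrite -(big_map _ xpredT (fun z => 'X - z%:P)) => /prod_XsubC_eq/permP <-.
rewrite count_map -sum1_card -sum1_count; apply: eq_bigl => i /=.
by rewrite inE.
Qed.

Lemma exists_mulmx0 (F : fieldType) p q (B : 'M[F]_(p, q)) : (q < p)%N ->
  exists2 y : 'rV_p, y != 0 & y *m B = 0.
Proof.
move=> qp; have /rowV0Pn[y yk y0] : kermx B != 0.
  rewrite kermx_eq0; apply: contraL qp => /eqP <-.
  by rewrite -leqNgt rank_leq_col.
by exists y => //; apply/sub_kermxP.
Qed.

Lemma qform_diag n (A P : 'M[algC]_n) d x : A = P ^t* *m diag_mx d *m P ->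
  qform A x = \sum_i d 0 i * `|(x *m P ^t*) 0 i| ^+ 2.
Proof.
move=> ->; rewrite /qform.
have -> : x *m (P ^t* *m diag_mx d *m P) *m x ^t* =
    (x *m P ^t*) *m diag_mx d *m (x *m P ^t*) ^t*.
  by rewrite trmx_mul map_mxM trmxCK !mulmxA.
move: (x *m _) => z; rewrite mul_mx_diag mxE; apply: eq_bigr => i _.
by rewrite !mxE normCK mulrAC mulrC.
Qed.

(** The columns of [M] are the eigenvectors with negative eigenvalue; on their orthogonal complement
    only nonnegative eigenvalues contribute. *)
Lemma neg_index_nonneg n (A : 'M[algC]_n) : symreal A ->
  exists M : 'M[algC]_(n, neg_index A),
    forall x, x *m M = 0 -> 0 <= qform A x.
Proof.
move=> sA; have [P [d [_ _ eA rd ->]]] := neg_index_spectral sA.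
set S := [set i | _]; exists (P ^t* *m colsub (enum_val : 'I_#|S| -> _) 1%:M).
move=> x; rewrite mulmxA mulmx_colsub mulmx1 => /rowP z0.
rewrite (qform_diag _ eA) sumr_ge0 // => i _.
have [iS|] := boolP (i \in S).
  have := z0 (enum_rank_in iS i); rewrite !mxE enum_rankK_in //= => h.
  by rewrite h normr0 expr0n mulr0.
rewrite inE -real_leNgt ?rd ?real0 // => d0.
by rewrite mulr_ge0 // exprn_ge0.
Qed.

(** With fewer than [k] negative eigenvalues, the constraints [M] would annihilate [phi y] for some
    nonzero [y], and the form would be nonnegative there. *)
Lemma neg_index_ge n (A : 'M[algC]_n) k (phi : 'rV[algC]_k -> 'rV[algC]_n) :
  symreal A -> linear phi -> (forall y, y != 0 -> qform A (phi y) < 0) ->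
  (k <= neg_index A)%N.
Proof.
move=> sA lphi neg; have [M posM] := neg_index_nonneg sA.
pose phiL : {linear 'rV[algC]_k -> 'rV[algC]_n} :=
  HB.pack phi (GRing.isLinear.Build _ _ _ _ phi lphi).
rewrite leqNgt; apply/negP => /(exists_mulmx0 (lin1_mx phiL *m M))[y y0].
by rewrite mulmxA mul_rV_lin1 => /posM; have /lt_geF/= -> := neg _ y0.
Qed.

Lemma neg_index_le n (A : 'M[algC]_n) k (l : 'rV[algC]_n -> 'rV[algC]_k) :
  symreal A -> linear l -> (forall x, l x = 0 -> 0 <= qform A x) ->
  (neg_index A <= k)%N.
Proof.
move=> sA ll pos; have [P [d [P1 P2 eA rd ->]]] := neg_index_spectral sA.
pose lL : {linear 'rV[algC]_n -> 'rV[algC]_k} :=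
  HB.pack l (GRing.isLinear.Build _ _ _ _ l ll).
rewrite leqNgt; apply/negP => lt; set S := [set i | _] in lt.
have lt2 : (k + #|~: S| < n)%N.
  by rewrite -[X in (_ < X)%N]card_ord -(cardsC S) ltn_add2r.
(* [z] holds eigenbasis coordinates. The constraints [l], together with vanishing at all nonnegative
   eigenvalues, are fewer than [n] equations, and any nonzero solution has a negative form. *)
have [z z0] := exists_mulmx0
  (row_mx (P *m lin1_mx lL) (colsub (enum_val : 'I_#|~: S| -> _) 1%:M)) lt2.
rewrite mul_mx_row mulmxA mul_rV_lin1 mulmx_colsub mulmx1 => /eqP.
rewrite row_mx_eq0 => /andP[/eqP/pos + /eqP/rowP zS].
rewrite (qform_diag _ eA) -mulmxA P1 mulmx1.
have neg i : d 0 i * `|z 0 i| ^+ 2 <= 0.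
  have [iS|] := boolP (i \in ~: S).
    have := zS (enum_rank_in iS i); rewrite !mxE enum_rankK_in //= => ->.
    by rewrite normr0 expr0n mulr0.
  by rewrite !inE negbK => /ltW d0; rewrite mulr_le0_ge0 // exprn_ge0.
move/le_gtF/negP; apply; have /rV0Pn[i zi0] := z0.
rewrite (bigD1 i) //= ltr_wnDr ?sumr_le0 //.
rewrite pmulr_llt0 ?exprn_gt0 ?normr_gt0 //.
have [iS|] := boolP (i \in ~: S); last by rewrite !inE negbK.
have := zS (enum_rank_in iS i); rewrite !mxE enum_rankK_in //= => z_i.
by rewrite z_i eqxx in zi0.
Qed.

Lemma qform_mul n k (A : 'M[algC]_n) (W : 'M_(k, n)) y :
  qform A (y *m W) = qform (W *m A *m W ^t*) y.
Proof. by rewrite /qform trmx_mul map_mxM !mulmxA. Qed.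

(** [B] is the form of [A] pulled back along [W], so the constraints for [A] pull back to
    constraints for [B]. This serves both for a cycle inside the graph and for relabelling a graph
    spanned by its cycle. *)
Lemma neg_index_congr n k (A : 'M[algC]_n) (B : 'M[algC]_k)
    (f : 'I_k -> 'I_n) (d : 'I_k -> algC) :
  symreal A -> (forall i, d i \is Num.real) ->
  (forall i j, B i j = d i * d j * A (f i) (f j)) ->
  (neg_index B <= neg_index A)%N.
Proof.
move=> sA rd eB; have [M posM] := neg_index_nonneg sA.
pose W : 'M[algC]_(k, n) := \matrix_(i, u) (d i * (f i == u)%:R).
have eW : W *m A *m W ^t* = B.
  have sumW (F : 'I_n -> algC) i : \sum_u W i u * F u = d i * F (f i).
    rewrite (bigD1 (f i)) //= big1 ?addr0 => [|u /negPf fiu].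
      by rewrite mxE eqxx mulr1.
    by rewrite mxE eq_sym fiu mulr0 mul0r.
  have WA i v : (W *m A) i v = d i * A (f i) v by rewrite mxE sumW.
  have Wt v j : W ^t* v j = W j v.
    by rewrite mxE [LHS]/= mxE; apply/CrealP; rewrite mxE realM ?rd ?realn.
  apply/matrixP => i j; rewrite eB mxE.
  under eq_bigr => v _ do rewrite WA Wt mulrC.
  by rewrite sumW mulrCA mulrA.
apply: (@neg_index_le _ _ _ (mulmxr (W *m M))).
- by split=> i j; rewrite !eB; [rewrite sA.1 [d i * _]mulrC |
    rewrite !realM ?rd ?sA.2].
- exact: linearP.
by move=> x /= h; rewrite -eW -qform_mul posM // -mulmxA.
Qed.

(* With [X], [Y] the coordinate rows of the [x i], [y i], [B = X A Y^T] and
   [C = Y A Y^T], the rows of [W = Y - (C + 1) B^-1 X / 2] have Gram matrix [-1]. *)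
Lemma neg_index_triangular n k (A : 'M[algC]_n) (x y : 'I_k -> 'I_n) :
  symreal A -> (forall i j, A (x i) (x j) = 0) ->
  (forall i, A (x i) (y i) != 0) ->
  (forall i j : 'I_k, (i < j)%N -> A (x i) (y j) = 0) ->
  (k <= neg_index A)%N.
Proof.
move=> sA xx xy xy0.
pose X : 'M[algC]_(k, n) := rowsub x 1%:M.
pose Y : 'M[algC]_(k, n) := rowsub y 1%:M.
pose B := mxsub x y A; pose C := mxsub y y A.
have uB : B \in unitmx.
  rewrite unitmxE det_trig; last by apply/is_trig_mxP => i j /xy0; rewrite mxE.
  by rewrite unitfE prodf_seq_neq0; apply/allP => i _; rewrite mxE xy.
pose K := - (2^-1 *: ((C + 1%:M) *m invmx B)).
have KB : K *m B = - (2^-1 *: (C + 1%:M)).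
  by rewrite mulNmx -scalemxAl mulmxKV.
have rA : A ^ Num.conj = A by apply/matrixP => i j; rewrite mxE; apply/CrealP/sA.2.
have rB : B ^ Num.conj = B by rewrite map_mxsub rA.
have rC : C ^ Num.conj = C by rewrite map_mxsub rA.
have tC : C^T = C by apply/matrixP => i j; rewrite !mxE sA.1.
have rK : K ^ Num.conj = K.
  rewrite map_mxN map_mxZ map_mxM map_invmx rB map_mxD rC map_mx1.
  by congr (- (_ *: _)); apply/CrealP; rewrite realV realn.
have sub (f h : 'I_k -> 'I_n) : rowsub f 1%:M *m A *m (rowsub h 1%:M)^T = mxsub f h A.
  by rewrite mul_rowsub_mx mul1mx trmx_mxsub trmx1 mulmx_colsub mulmx1 -mxsubcr.
have rS (f : 'I_k -> 'I_n) : (rowsub f 1%:M : 'M[algC]_(k, n)) ^ Num.conj = rowsub f 1%:M.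
  by rewrite map_mxsub map_mx1.
pose W := Y + K *m X.
have WAW : W *m A *m W ^t* = - 1%:M.
  have rW : W ^ Num.conj = W by rewrite map_mxD map_mxM rK !rS.
  rewrite -map_trmx rW linearD /= trmx_mul.
  have -> : (Y + K *m X) *m A *m (Y^T + X^T *m K^T) =
      Y *m A *m Y^T + (Y *m A *m X^T) *m K^T + K *m (X *m A *m Y^T)
      + K *m (X *m A *m X^T) *m K^T.
    by rewrite !(mulmxDl, mulmxDr) !mulmxA !addrA -[in LHS]addrA addrACA addrA.
  rewrite !sub -/B -/C.
  have -> : mxsub x x A = 0 by apply/matrixP => i j; rewrite !mxE.
  have -> : mxsub y x A = B^T by apply/matrixP => i j; rewrite !mxE sA.1.
  rewrite mulmx0 mul0mx addr0 -trmx_mul KB linearN linearZ linearD /=.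
  rewrite tC trmx1; apply/matrixP => i j; rewrite !mxE.
  rewrite -addrA -opprD -mulr2n -(mulr_natl (_ * _)) mulVKf ?pnatr_eq0 //.
  by rewrite opprD addrA subrr add0r.
apply: (@neg_index_ge _ _ _ (mulmxr W)) => // [|v v0]; first exact: linearP.
rewrite /= qform_mul WAW /qform mulmxN mulmx1 mulNmx mxE oppr_lt0.
by rewrite -dotmxE dnorm_gt0.
Qed.

(** The form is the sum over the parts of the squared moduli of the [t]-weighted part sums, minus
    that of the total sum; the single constraint kills the total. *)
Lemma neg_index_multipartite n (A : 'M[algC]_n) (I : finType)
    (f : 'I_n -> I) (t : 'I_n -> algC) :
  (forall u, t u \is Num.real) ->
  (forall u v, A u v = if f u == f v then 0 else - (t u * t v)) ->
  (neg_index A <= 1)%N.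
Proof.
move=> rt eA.
have sA : symreal A.
  split=> u v; rewrite !eA; first by rewrite eq_sym mulrC.
  by case: ifP => _; rewrite ?real0 // realN realM.
pose S (P : pred 'I_n) (x : 'rV[algC]_n) := \sum_(u | P u) x 0 u * t u.
apply: (@neg_index_le _ _ 1 (fun x => \row__ S xpredT x) sA) => [a x y|x].
  apply/rowP => i; rewrite !mxE /S mulr_sumr -big_split /=.
  by apply: eq_bigr => u _; rewrite !mxE mulrDl mulrA.
move=> /rowP/(_ 0); rewrite !mxE => S0.
have -> : qform A x = \sum_i `|S (fun u => f u == i) x| ^+ 2.
  rewrite qformE (partition_big f xpredT) //=; apply: eq_bigr => i _.
  rewrite normCK /S rmorph_sum mulr_sumr; apply: eq_bigr => v /eqP fv.
  rewrite rmorphM /= (CrealP (rt v)) mulrCA mulrC; congr (_ * _).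
  (* Column [v] only meets the other parts, which contribute minus the total plus the sum over the
     part of [v]. *)
  transitivity (t v * (S (fun u => f u == i) x - S xpredT x)).
    rewrite /S [X in _ - X](bigID (fun u => f u == i)) /= opprD addrA subrr add0r.
    rewrite -sumrN mulr_sumr [RHS]big_mkcond; apply: eq_bigr => u _ /=.
    rewrite eA fv; case: eqP => _ /=; first by rewrite mulr0.
    by rewrite mulrN mulrA mulrN mulrC.
  by rewrite S0 subr0 mulrC.
by rewrite sumr_ge0 // => i _; rewrite exprn_ge0.
Qed.

(** * Inertia of a cycle with alternating edge weights and closing weight [s] *)

Definition cycle_mx (p : nat) (s : algC) : 'M[algC]_p.+1 :=
  \matrix_(i, j) ((j == i.+1 :> nat)%:R * (-1) ^+ i
    + (i == j.+1 :> nat)%:R * (-1) ^+ j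
    + ((i == 0 :> nat) && (j == p :> nat))%:R * s
    + ((j == 0 :> nat) && (i == p :> nat))%:R * s).

Lemma symreal_cycle_mx p s : s \is Num.real -> symreal (cycle_mx p s).
Proof.
move=> rs; split=> i j; rewrite !mxE.
  by rewrite -!addrA addrCA; congr (_ + (_ + _)); rewrite addrC.
by rewrite !realD // realM // ?realn // realX // realN real1.
Qed.

Lemma sum_succ p (F : nat -> nat -> algC) :
  \sum_(i < p.+1) \sum_(j < p.+1) (j == i.+1 :> nat)%:R * F i j =
  \sum_(i < p) F i i.+1.
Proof.
rewrite big_ord_recr /= [X in _ + X]big1 ?addr0 => [|j _]; last first.
  by rewrite ltn_eqF ?mul0r.
apply: eq_bigr => i _; rewrite (bigD1 (lift ord0 i)) //= /bump /= eqxx mul1r.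
rewrite big1 ?addr0 // => j /eqP jli.
by case: eqP => [e|_]; [case: jli; apply/val_inj | rewrite mul0r].
Qed.

Lemma sum_corner p (F : nat -> nat -> algC) :
  \sum_(i < p.+1) \sum_(j < p.+1)
     ((i == 0 :> nat) && (j == p :> nat))%:R * F i j = F 0 p.
Proof.
rewrite (bigD1 ord0) //= [X in _ + X]big1 ?addr0 => [|i i0]; last first.
  rewrite big1 // => j _; case: eqP => [e|]; last by rewrite mul0r.
  by case/eqP: i0; apply/val_inj.
rewrite (bigD1 ord_max) //= eqxx mul1r big1 ?addr0 // => j jm.
case: eqP => [e|_]; last by rewrite mul0r.
by case/eqP: jm; apply/val_inj.
Qed.

Definition twiceRe (z : algC) : algC := z + z^*.

Lemma qform_cycle_mx p s (F : nat -> algC) :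
  qform (cycle_mx p s) (\row_j F j) =
  \sum_(i < p) (-1) ^+ i * twiceRe ((F i)^* * F i.+1) + s * twiceRe ((F 0)^* * F p).
Proof.
pose G i j := F i * (F j)^*.
transitivity (\sum_(i < p.+1) \sum_(j < p.+1)
    ((j == i.+1 :> nat)%:R * ((-1) ^+ i * G i j)
   + (i == j.+1 :> nat)%:R * ((-1) ^+ j * G i j)
   + ((i == 0 :> nat) && (j == p :> nat))%:R * (s * G i j)
   + ((j == 0 :> nat) && (i == p :> nat))%:R * (s * G i j))).
  rewrite qformE; under eq_bigr => i _ do rewrite mulr_suml.
  rewrite exchange_big /=; apply: eq_bigr => i _; apply: eq_bigr => j _.
  by rewrite !mxE /G; ring.
under eq_bigr => i _ do rewrite 3!big_split /=.
rewrite 3!big_split /= [X in _ + X + _ + _]exchange_big.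
rewrite [X in _ + X]exchange_big /=.
rewrite (sum_succ _ (fun i j => (-1) ^+ i * G i j)).
rewrite (sum_succ _ (fun i j => (-1) ^+ i * G j i)).
rewrite (sum_corner _ (fun i j => s * G i j)).
rewrite (sum_corner _ (fun i j => s * G j i)).
rewrite -big_split /= -addrA; congr (_ + _).
  by apply: eq_bigr => i _; rewrite /twiceRe /G rmorphM /= conjCK; ring.
by rewrite /twiceRe /G rmorphM /= conjCK; ring.
Qed.

Lemma twiceReD a b : twiceRe (a + b) = twiceRe a + twiceRe b.
Proof. by rewrite /twiceRe rmorphD /=; ring. Qed.

Lemma twiceReN a : twiceRe (- a) = - twiceRe a.
Proof. by rewrite /twiceRe rmorphN /=; ring. Qed.

Lemma twiceRe_norm a : twiceRe (a^* * a) = 2 * `|a| ^+ 2.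
Proof. by rewrite /twiceRe rmorphM /= conjCK /= normCK; ring. Qed.

(* [E] lists the even-indexed coordinates and [Y] the odd-indexed ones, shifted
   by one so that [Y 0] stands for the coordinate before [0] on the cycle. *)
Definition interleave (E Y : nat -> algC) (i : nat) : algC :=
  if odd i then Y (i.+1)./2 else E i./2.

Lemma interleave_even E Y i : interleave E Y i.*2 = E i.
Proof. by rewrite /interleave odd_double doubleK. Qed.

Lemma interleave_odd E Y i : interleave E Y i.*2.+1 = Y i.+1.
Proof. by rewrite /interleave /= odd_double /= doubleK. Qed.

(** An even vertex meets its two odd neighbours with opposite weights, hence their difference. The
    subtracted terms correct for the two ends of the path; induction adds two edges at a time. *)
Lemma alternating_path_form m (E Y : nat -> algC) :
  \sum_(i < m.*2) (-1) ^+ i *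
     twiceRe ((interleave E Y i)^* * interleave E Y i.+1) - twiceRe ((E 0)^* * Y 0) =
  \sum_(i < m) twiceRe ((E i)^* * (Y i.+1 - Y i)) - twiceRe ((E m)^* * Y m).
Proof.
elim: m => [|m IH]; first by rewrite !big_ord0.
move/(canRL (subrK _)): IH => IH; rewrite doubleS 3!big_ord_recr /= IH.
rewrite exprS -signr_odd odd_double mulr1 mul1r.
rewrite -doubleS interleave_odd !interleave_even mulN1r.
rewrite mulrBr twiceReD twiceReN.
have -> : twiceRe ((Y m.+1)^* * E m.+1) = twiceRe ((E m.+1)^* * Y m.+1).
  by rewrite /twiceRe !rmorphM /= !conjCK addrC mulrC [X in _ + X]mulrC.
ring.
Qed.

(** The condition on [Y 0] turns the closing edge into the correction at the start of the path. The
    last vertex is even and has no odd successor, so the term in [E m] survives. *)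
Lemma qform_odd_cycle m s (E Y : nat -> algC) : Y 0 = - s * E m ->
  s \is Num.real ->
  qform (cycle_mx m.*2 s) (\row_j interleave E Y j) =
  \sum_(i < m) twiceRe ((E i)^* * (Y i.+1 - Y i)) - twiceRe ((E m)^* * Y m).
Proof.
move=> Y0 /CrealP rs; rewrite qform_cycle_mx -alternating_path_form.
congr (_ + _); rewrite interleave_even -[interleave E Y 0]/(E 0%N).
by rewrite Y0 /twiceRe !rmorphM /= rmorphN /= rs; ring.
Qed.

(** Here the last vertex is odd, so the closing edge supplies the missing predecessor of vertex [0]
    and no end term survives. *)
Lemma qform_even_cycle m s (E Y : nat -> algC) : Y 0 = - s * Y m.+1 ->
  s \is Num.real ->
  qform (cycle_mx m.*2.+1 s) (\row_j interleave E Y j) =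
  \sum_(i < m.+1) twiceRe ((E i)^* * (Y i.+1 - Y i)).
Proof.
move=> Y0 /CrealP rs; rewrite qform_cycle_mx big_ord_recr /=.
have := alternating_path_form m E Y => /(canRL (subrK _)) ->.
rewrite big_ord_recr /= interleave_odd !interleave_even.
rewrite -signr_odd odd_double mul1r -[interleave E Y 0]/(E 0%N) mulrBr twiceReD twiceReN.
have -> : s * twiceRe ((E 0)^* * Y m.+1) = - twiceRe ((E 0)^* * Y 0).
  by rewrite Y0 /twiceRe !rmorphM /= rmorphN /= rs; ring.
ring.
Qed.

(** Entry [0] is the virtual predecessor of vertex [0] that the closing edge prescribes; [p] is the
    last vertex for either parity. *)
Definition shifted_odd p s (x : 'rV[algC]_p.+1) (i : nat) : algC :=
  if i is i'.+1 then x 0 (inord i'.*2.+1) else - s * x 0 (inord p).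

Lemma row_interleave p s (x : 'rV[algC]_p.+1) :
  x = \row_j interleave (fun i => x 0 (inord i.*2)) (shifted_odd s x) j.
Proof.
apply/rowP => j; rewrite mxE -[in LHS](inord_val j); move: (nat_of_ord j) => i.
rewrite -(odd_double_half i); case: (odd i); rewrite ?add1n ?add0n.
  by rewrite interleave_odd.
by rewrite interleave_even.
Qed.

Lemma linear_shifted_odd_diff p s k :
  linear (fun x : 'rV[algC]_p.+1 =>
            \row_(i < k) (shifted_odd s x i.+1 - shifted_odd s x i)).
Proof.
move=> a x y; apply/rowP => -[[|i] ltik]; rewrite !mxE /= !mxE; ring.
Qed.

Lemma shifted_odd_const p s k (x : 'rV[algC]_p.+1) :
  \row_(i < k) (shifted_odd s x i.+1 - shifted_odd s x i) = 0 ->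
  forall i, (i <= k)%N -> shifted_odd s x i = shifted_odd s x 0.
Proof.
move=> /rowP x0; elim=> // i IH lik; rewrite -IH 1?ltnW //.
by apply/eqP; rewrite -subr_eq0; have := x0 (Ordinal lik); rewrite !mxE => ->.
Qed.

(** Once the [m] differences vanish, [Y m = Y 0 = - E m], and the surviving end term is
    [2 |E m|^2]. *)
Lemma neg_index_odd_cycle_le m : (neg_index (cycle_mx m.*2 1%R) <= m)%N.
Proof.
apply: (neg_index_le (symreal_cycle_mx _ (real1 _))
  (@linear_shifted_odd_diff _ 1 m)) => x /shifted_odd_const Yc.
rewrite [x](row_interleave 1) qform_odd_cycle ?real1 //.
rewrite big1 => [|i _]; last first.
  by rewrite (Yc i.+1) // (Yc i) 1?ltnW // subrr mulr0 /twiceRe rmorph0 addr0.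
rewrite Yc //= mulN1r mulrN twiceReN twiceRe_norm sub0r opprK.
by rewrite mulr_ge0 ?exprn_ge0.
Qed.

(** With [s = -1] the sequence [Y] is periodic, so [m] vanishing differences force the last one to
    vanish and the form is zero. *)
Lemma neg_index_even_cycle_le m : (neg_index (cycle_mx m.*2.+1 (-1)%R) <= m)%N.
Proof.
have r1 : (-1 : algC) \is Num.real by rewrite realN real1.
apply: (neg_index_le (symreal_cycle_mx _ r1)
  (@linear_shifted_odd_diff _ (-1) m)) => x /shifted_odd_const Yc.
rewrite [x](row_interleave (-1)) qform_even_cycle //.
rewrite big1 // => i _; rewrite (Yc i) -1?ltnS //.
have [->|im] := eqVneq (i : nat) m; last first.
  have lim: (i < m)%N by rewrite ltn_neqAle im -ltnS ltn_ord.
  by rewrite (Yc i.+1) // subrr mulr0 /twiceRe rmorph0 addr0.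
by rewrite /= opprK mul1r subrr mulr0 /twiceRe rmorph0 addr0.
Qed.

Lemma linear_row_interleave n k (E Y : 'rV[algC]_k -> nat -> algC) :
  (forall i a x y, E (a *: x + y) i = a * E x i + E y i) ->
  (forall i a x y, Y (a *: x + y) i = a * Y x i + Y y i) ->
  linear (fun x => \row_(j < n) interleave (E x) (Y x) j).
Proof.
move=> lE lY a x y; apply/rowP => j; rewrite !mxE /interleave.
by case: ifP; rewrite ?lE ?lY.
Qed.

(** The odd coordinates are free and [E] is minus the differences of [Y], so the form is [-2] times
    the sum of their squares. It vanishes only for constant [Y], and [Y 0 = - Y m.+1] then forces
    [Y = 0]. *)
Lemma neg_index_even_cycle_ge m : (m < neg_index (cycle_mx m.*2.+1 1%R))%N.
Proof.
pose Y (y : 'rV[algC]_m.+1) i :=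
  if i is i'.+1 then y 0 (inord i') else - y 0 (inord m).
have lY i a x y : Y (a *: x + y) i = a * Y x i + Y y i.
  by case: i => [|i] /=; rewrite !mxE //; ring.
pose E y i := - (Y y i.+1 - Y y i).
have lE i a x y : E (a *: x + y) i = a * E x i + E y i.
  by rewrite /E !lY; ring.
have lin := @linear_row_interleave m.*2.+2 _ _ _ lE lY.
apply: (neg_index_ge (symreal_cycle_mx _ (real1 _)) lin).
move=> y y0; rewrite qform_even_cycle ?real1 //; last by rewrite mulN1r.
have -> : \sum_(i < m.+1) twiceRe ((E y i)^* * (Y y i.+1 - Y y i)) =
    - 2 * \sum_(i < m.+1) `|E y i| ^+ 2.
  rewrite mulr_sumr; apply: eq_bigr => i _.
  rewrite mulNr -twiceRe_norm -twiceReN -mulrN; congr (twiceRe (_ * _)).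
  by rewrite /E opprK.
rewrite mulNr oppr_lt0 mulr_gt0 // lt_neqAle sumr_ge0 => [|i _]; last exact: exprn_ge0.
rewrite andbT eq_sym; apply: contra_neq y0 => /psumr_eq0P E0.
have Yc i : (i <= m.+1)%N -> Y y i = Y y 0%N.
  elim: i => // i IH im; rewrite -IH 1?ltnW //.
  have := E0 (fun i _ => exprn_ge0 _ (normr_ge0 _)) (Ordinal im) isT.
  by move/eqP; rewrite expf_eq0 normr_eq0 /= oppr_eq0 subr_eq0 => /eqP.
have ym : y 0 (inord m) = 0.
  have /eqP := Yc m.+1 (leqnn _).
  by rewrite -addr_eq0 -mulr2n -mulr_natl mulf_eq0 pnatr_eq0 => /eqP.
apply/rowP => j; rewrite mxE -[j]inord_val.
by have := Yc j.+1 (ltn_ord j); rewrite /= ym oppr0.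
Qed.

(** The parameters are [z], the common value of [Y 0] and [E m], and the [m] differences [l] of [Y].
    With [E i = z - l i] the cross terms cancel, leaving minus twice the sum of squares. *)
Lemma neg_index_odd_cycle_ge m : (m < neg_index (cycle_mx m.*2 (-1)%R))%N.
Proof.
have r1 : (-1 : algC) \is Num.real by rewrite realN real1.
pose z (y : 'rV[algC]_m.+1) := y 0 ord_max.
(* The default [0] at index [m] gives [E m = z], as the closing condition requires. *)
pose l (y : 'rV[algC]_m.+1) i := if (i < m)%N then y 0 (inord i) else 0.
pose Y y i := z y + \sum_(j < i) l y j.
pose E y i := z y - l y i.
have lz a x y : z (a *: x + y) = a * z x + z y by rewrite /z !mxE.
have ll i a x y : l (a *: x + y) i = a * l x i + l y i.
  by rewrite /l; case: ifP => _; rewrite ?mxE // mulr0 addr0.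
have lY i a x y : Y (a *: x + y) i = a * Y x i + Y y i.
  rewrite /Y lz; under eq_bigr => j _ do rewrite ll.
  by rewrite big_split /= -mulr_sumr; ring.
have lE i a x y : E (a *: x + y) i = a * E x i + E y i by rewrite /E lz ll; ring.
have lin := @linear_row_interleave m.*2.+1 _ _ _ lE lY.
apply: (neg_index_ge (symreal_cycle_mx _ r1) lin).
move=> y y0; rewrite qform_odd_cycle //; last first.
  by rewrite /Y /E big_ord0 /l ltnn; ring.
have dY i : Y y i.+1 - Y y i = l y i by rewrite /Y big_ord_recr /=; ring.
under eq_bigr => i _ do rewrite dY.
have -> : \sum_(i < m) twiceRe ((E y i)^* * l y i) - twiceRe ((E y m)^* * Y y m) =
    - 2 * (\sum_(i < m) `|l y i| ^+ 2 + `|z y| ^+ 2).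
  have -> : E y m = z y by rewrite /E /l ltnn subr0.
  rewrite /Y mulrDr twiceReD twiceRe_norm mulr_sumr.
  have -> : twiceRe (\sum_(i < m) (z y)^* * l y i) = \sum_(i < m) twiceRe ((z y)^* * l y i).
    by rewrite /twiceRe rmorph_sum -big_split.
  have -> : \sum_(i < m) twiceRe ((E y i)^* * l y i) =
     \sum_(i < m) twiceRe ((z y)^* * l y i) - 2 * \sum_(i < m) `|l y i| ^+ 2.
    rewrite mulr_sumr -sumrB; apply: eq_bigr => i _.
    by rewrite -twiceRe_norm -twiceReN -twiceReD /E rmorphB mulrBl.
  ring.
rewrite mulNr oppr_lt0 mulr_gt0 //.
have sge0 : 0 <= \sum_(i < m) `|l y i| ^+ 2 by apply: sumr_ge0 => i _; apply: exprn_ge0.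
have [z0|z0] := eqVneq (z y) 0; last by rewrite ltr_wpDl ?exprn_gt0 ?normr_gt0.
rewrite z0 normr0 expr0n addr0 lt_neqAle sge0 andbT eq_sym.
apply: contra_neq y0 => /psumr_eq0P l0; apply/rowP => j; rewrite mxE.
have [/eqP jm|jm] := boolP (j == m :> nat).
  by rewrite -z0 /z; congr (y 0 _); apply/val_inj.
have ltjm : (j < m)%N by rewrite ltn_neqAle jm -ltnS ltn_ord.
have := l0 (fun i _ => exprn_ge0 _ (normr_ge0 _)) (Ordinal ltjm) isT.
move/eqP; rewrite expf_eq0 normr_eq0 /= /l ltjm => /eqP.
by rewrite inord_val.
Qed.

(** * Shortest cycles in a signed graph: triangular pairs, switching and sign *)

Lemma cycle_negative_cons n (sigma : 'I_n -> 'I_n -> bool) x0 x p :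
  cycle_negative sigma (x :: p) =
  (\big[addb/false]_(i < size p)
     sigma (nth x0 (x :: p) i) (nth x0 (x :: p) i.+1)) (+) sigma (last x p) x.
Proof.
rewrite /cycle_negative rot1_cons; move: {2 6}x => y.
elim: p x => [|z p IH] x; first by rewrite big_ord0 /= addn0 oddb.
by rewrite big_ord_recl /= oddD oddb IH addbA.
Qed.

Section SignedGraph.
Variables (n : nat) (adj : rel 'I_n) (sigma : 'I_n -> 'I_n -> bool).
Hypotheses (adjC : symmetric adj) (adjI : irreflexive adj).
Hypothesis sigmaC : forall u v, sigma u v = sigma v u.
Local Notation A := (sadj_mx adj sigma).

Lemma sadj_mxE u v : A u v = (adj u v)%:R * (-1) ^+ sigma u v.
Proof. by rewrite mxE; case: (adj u v); case: (sigma u v); rewrite ?mul1r ?mul0r. Qed.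

Lemma sadj_mx_eq0 u v : (A u v == 0) = ~~ adj u v.
Proof. by rewrite sadj_mxE mulf_eq0 signr_eq0 orbF pnatr_eq0 eqb0. Qed.

Lemma symreal_sadj_mx : symreal A.
Proof.
split=> u v; first by rewrite !sadj_mxE adjC sigmaC.
by rewrite sadj_mxE realM ?realn // realX // realN real1.
Qed.

Lemma neg_index_sadj_triangular k (x y : 'I_k -> 'I_n) :
  (forall i j, ~~ adj (x i) (x j)) -> (forall i, adj (x i) (y i)) ->
  (forall i j : 'I_k, (i < j)%N -> ~~ adj (x i) (y j)) ->
  (k <= neg_index A)%N.
Proof.
move=> xx xy xy0; apply: (neg_index_triangular symreal_sadj_mx (x := x) (y := y)).
- by move=> i j; apply/eqP; rewrite sadj_mx_eq0.
- by move=> i; rewrite sadj_mx_eq0 negbK.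
by move=> i j ij; apply/eqP; rewrite sadj_mx_eq0 xy0.
Qed.

(** The pairs of consecutive vertices stop before the last vertex of [c], so the closing edge never
    breaks triangularity. *)
Lemma shortest_cycle_neg_index c : shortest_cycle adj c ->
  ((uphalf (size c)).-1 <= neg_index A)%N.
Proof.
move=> sc; have s3 : (3 <= size c)%N by case: sc => /andP[].
have x0 : 'I_n by case: (c) s3 => // x.
have ch := shortest_cycle_chordless adjC x0 sc.
pose v := nth x0 c; apply: (@neg_index_sadj_triangular _
  (fun i => v (i : nat).*2) (fun i => v (i : nat).*2.+1)).
- move=> i j; have := ltn_ord i; have := ltn_ord j.
  wlog lij : i j / (i <= j)%N => [hw|].
    by case/orP: (leq_total i j) => l *; [|rewrite adjC]; apply: hw.
  move: lij; rewrite leq_eqVlt => /orP[/eqP-> _ _|ij hj hi]; first by rewrite adjI.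
  by rewrite ch; lia.
- by move=> i; have := ltn_ord i => hi; rewrite ch ?eqxx //; lia.
- by move=> i j ij; have := ltn_ord j => hj; rewrite ch; lia.
Qed.

(** The pair of [w] and [v 0] goes first, as [w] sees nothing else on [c]. The cycle pairs then
    start at [v 1]; [v 0] occurs only as the first [y], so the closing edge is harmless and one more
    pair fits. *)
Lemma pendant_neg_index c w : shortest_cycle adj c -> (5 <= size c)%N ->
  w \notin c -> adj w (nth w c 0) -> (uphalf (size c) <= neg_index A)%N.
Proof.
move=> sc c5 wc w0.
have ch := shortest_cycle_chordless adjC w sc.
have un := shortest_cycle_ear_unique adjC sc c5 wc w0.
pose v := nth w c; apply: (@neg_index_sadj_triangular _
  (fun i => if (i : nat) is i'.+1 then v i'.*2.+1 else w)
  (fun i => if (i : nat) is i'.+1 then v i'.*2.+2 else v 0%N)).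
- move=> i j; wlog lij : i j / (i <= j)%N => [hw|].
    by case/orP: (leq_total i j) => l *; [|rewrite adjC]; apply: hw.
  case: i j lij => [i hi] [j hj] /=; rewrite leq_eqVlt => /orP[/eqP->|ij].
    by rewrite adjI.
  case: i j hi hj ij => [|i] [|j] //= hi hj ij.
    by apply/negP => /un; lia.
  by rewrite ch; lia.
- by move=> [[|i] hi] //=; rewrite ch ?eqxx //; lia.
move=> [i hi] [j hj] /= ij; case: i j hi hj ij => [|i] [|j] //= hi hj ij.
  by apply/negP => /un; lia.
by rewrite ch; lia.
Qed.

(** The switching function along [v] is solved for recursively so that the edge from [v i] to
    [v i.+1] gets sign [(-1)^i]. *)
Fixpoint switch_sign (v : nat -> 'I_n) (i : nat) : bool :=
  if i is i'.+1 then switch_sign v i' (+) sigma (v i') (v i) (+) odd i'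
  else false.

(** The summand [odd p./2] is the parity of the number of odd indices below [p]. *)
Lemma switch_signE v p :
  switch_sign v p =
  (\big[addb/false]_(i < p) sigma (v i) (v i.+1)) (+) odd p./2.
Proof.
elim: p => [|p IH]; first by rewrite big_ord0.
rewrite big_ord_recr /= IH uphalf_half oddD oddb.
by rewrite -!addbA; congr (_ (+) _); rewrite addbCA; congr (_ (+) _); rewrite addbC.
Qed.

(* The weight of the closing edge once the other edges have been switched to
   [(-1)^i]. *)
Definition cycle_sign (c : seq 'I_n) : algC :=
  (-1) ^+ (cycle_negative sigma c (+) odd (size c).-1./2).

(** A shortest cycle is induced, so its block of [A] has only consecutive and corner entries.
    Switching fixes the former, and the corner then carries the product of all signs around the
    cycle. *)
Lemma cycle_mx_switch x0 c p (i j : 'I_p.+1) :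
  shortest_cycle adj c -> size c = p.+1 ->
  let d k : algC := (-1) ^+ switch_sign (nth x0 c) k in
  cycle_mx p (cycle_sign c) i j = d i * d j * A (nth x0 c i) (nth x0 c j).
Proof.
move=> sc cp d.
have s3 : (3 <= size c)%N by case: sc => /andP[].
have sr : cycle_sign c \is Num.real by rewrite realX // realN real1.
have ch := shortest_cycle_chordless adjC x0 sc.
wlog lij : i j / (i <= j)%N => [hw|].
  case/orP: (leq_total i j) => l; first exact: hw.
  rewrite (symreal_cycle_mx p sr).1 symreal_sadj_mx.1 hw //.
  by rewrite [d j * _]mulrC.
move: lij; rewrite leq_eqVlt => /orP[/eqP/val_inj<-|ij].
  rewrite sadj_mxE adjI mul0r mulr0 mxE.
  have -> : (i == i.+1 :> nat) = false by lia.
  have -> : (i == 0 :> nat) && (i == p :> nat) = false by lia.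
  by rewrite !mul0r !addr0.
have hj := ltn_ord j; rewrite mxE sadj_mxE ch ?ij ?cp //=.
have -> : (i == j.+1 :> nat) = false by lia.
have -> : (j == 0 :> nat) && (i == p :> nat) = false by lia.
case: eqP => [ji|_] /=.
  have -> : (i == 0 :> nat) && (j == p :> nat) = false by lia.
  rewrite !mul0r !addr0 !mul1r ji /d /= -!signr_addb -signr_odd; congr (_ ^+ _).
  by rewrite -!addbA addKb addbCA addbb addbF.
case: andP => [[/eqP i0 /eqP jp]|_]; last by rewrite !mul0r mulr0 !addr0.
rewrite !mul0r !addr0 !add0r !mul1r i0 jp /d /= mul1r -signr_addb /cycle_sign.
rewrite switch_signE cp /=.
case: c cp {sc s3 sr ch d} => // y q [<-]; rewrite (cycle_negative_cons _ x0).
by rewrite (last_nth x0) sigmaC; congr (_ ^+ _); rewrite addbAC.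
Qed.

Lemma cycle_mx_le_neg_index c p : shortest_cycle adj c -> size c = p.+1 ->
  (neg_index (cycle_mx p (cycle_sign c)) <= neg_index A)%N.
Proof.
move=> sc cp; have x0 : 'I_n by case: (c) cp => // x.
apply: (neg_index_congr symreal_sadj_mx _
  (fun i j => cycle_mx_switch x0 i j sc cp)) => i.
by rewrite realX // realN real1.
Qed.

Lemma neg_index_le_cycle_mx c p : shortest_cycle adj c -> size c = p.+1 ->
  (forall x, x \in c) ->
  (neg_index A <= neg_index (cycle_mx p (cycle_sign c)))%N.
Proof.
move=> sc cp all_c; have x0 : 'I_n by case: (c) cp => // x.
have sr : cycle_sign c \is Num.real by rewrite realX // realN real1.
apply: (@neg_index_congr _ _ _ A (fun u => inord (index u c))
  (fun u => (-1) ^+ switch_sign (nth x0 c) (index u c)) (symreal_cycle_mx p sr)).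
  by move=> i; rewrite realX // realN real1.
move=> u v.
have idx w : (inord (index w c) : 'I_p.+1) = index w c :> nat.
  by apply: inordK; rewrite -cp index_mem.
rewrite (cycle_mx_switch x0) // !idx !nth_index // mulrA mulrACA.
by rewrite -!expr2 !sqrr_sign !mul1r.
Qed.

(* The signs for which [C_g] has [ceil(g/2) - 1] negative eigenvalues; the other
   sign gives one more. *)
Definition good_sign (c : seq 'I_n) : bool :=
  cycle_negative sigma c == (1 < size c %% 4)%N.

(** The residue modulo 4 enters through the parity of [(g - 1) / 2]. A good sign thus means closing
    weight [1] for odd length and [-1] for even length. *)
Lemma cycle_signE c : (3 <= size c)%N ->
  cycle_sign c = (-1) ^+ (good_sign c (+) odd (size c)).
Proof.
move=> s3; rewrite /cycle_sign /good_sign; congr (_ ^+ _).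
case: (cycle_negative _ _); rewrite ?addbF ?addFb ?addTb; lia.
Qed.

Lemma bad_sign_neg_index c : shortest_cycle adj c -> ~~ good_sign c ->
  (uphalf (size c) <= neg_index A)%N.
Proof.
move=> sc bad; have s3 : (3 <= size c)%N by case: sc => /andP[].
have cp : size c = (size c).-1.+1 by rewrite prednK //; lia.
apply: leq_trans (cycle_mx_le_neg_index sc cp).
rewrite cycle_signE // (negPf bad) addFb.
have [oc|oc] := boolP (odd (size c)).
  have -> : (size c).-1 = (size c)./2.*2 by lia.
  by rewrite expr1 uphalf_half oc neg_index_odd_cycle_ge.
have -> : (size c).-1 = (size c)./2.-1.*2.+1 by lia.
by rewrite expr0; apply: leq_trans (neg_index_even_cycle_ge _); lia.
Qed.

Lemma good_sign_neg_index c : shortest_cycle adj c -> good_sign c ->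
  (forall x, x \in c) -> (neg_index A <= (uphalf (size c)).-1)%N.
Proof.
move=> sc good all_c; have s3 : (3 <= size c)%N by case: sc => /andP[].
have cp : size c = (size c).-1.+1 by rewrite prednK //; lia.
apply: leq_trans (neg_index_le_cycle_mx sc cp all_c) _.
rewrite cycle_signE // good addTb.
have [oc|oc] := boolP (odd (size c)).
  have -> : (size c).-1 = (size c)./2.*2 by lia.
  by rewrite expr0 uphalf_half oc neg_index_odd_cycle_le.
have -> : (size c).-1 = (size c)./2.-1.*2.+1 by lia.
by rewrite expr1; apply: leq_trans (neg_index_even_cycle_le _) _; lia.
Qed.

End SignedGraph.

(** * The equality case: multipartite structure, signatures and spanning cycles *)

Section Multipartite.
Variables (n : nat) (adj : rel 'I_n) (sigma : 'I_n -> 'I_n -> bool).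
Hypotheses (adjC : symmetric adj) (adjI : irreflexive adj).
Hypothesis sigmaC : forall u v, sigma u v = sigma v u.
Local Notation A := (sadj_mx adj sigma).

(** Otherwise [w] with any neighbour [y], followed by [u] with [v], would form two triangular pairs;
    connectedness provides [y]. *)
Lemma neg_index1_adj u v w : connected_graph adj -> (neg_index A <= 1)%N ->
  adj u v -> adj w u || adj w v.
Proof.
move=> conn neg1 uv; apply: contraLR neg1 => /norP[wu wv]; rewrite -ltnNge.
have [y wy] : exists y, adj w y.
  have /connectP[[|y p] /= pp e] := conn w u.
    by case/negP: wv; rewrite -e.
  by exists y; case/andP: pp.
apply: (neg_index_sadj_triangular adjC sigmaC (k := 2)
  (x := fun i => if i == 0 then w else u) (y := fun i => if i == 0 then y else v)).
- by move=> i j; do 2!case: ifP => _; rewrite ?adjI // adjC.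
- by move=> i; case: ifP.
by move=> [[|[|i]] hi] [[|[|j]] hj].
Qed.

(** Read contrapositively, the hypothesis says that nonadjacency is transitive; the parts are its
    classes, encoded as sets of non-neighbours. *)
Lemma complete_multipartiteP (x0 : 'I_n) :
  (forall u v w, adj u v -> adj w u || adj w v) ->
  exists l, complete_multipartite adj l.
Proof.
move=> tr; pose cls x := [set y | ~~ adj x y].
pose P := [set cls x | x in 'I_n].
have Px x : cls x \in P by apply: imset_f.
exists #|P|, (fun x => enum_rank_in (Px x0) (cls x)); split=> [i|u v].
  have /imsetP[x _ e] := enum_valP i; exists x.
  by rewrite -e enum_valK_in.
rewrite -[LHS]negbK; congr (~~ _); apply/idP/eqP => [nuv|]; last first.
  move=> /(enum_rank_in_inj (Px u) (Px v)) e; have: v \in cls v by rewrite inE adjI.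
  by rewrite -e inE.
congr enum_rank_in; apply/setP => w; rewrite !inE; congr (~~ _).
apply/idP/idP => [/(tr _ _ v)|/(tr _ _ u)].
  by rewrite adjC (negPf nuv).
by rewrite (negPf nuv).
Qed.

Lemma complete_multipartite_ge2 l u v : complete_multipartite adj l ->
  adj u v -> (2 <= l)%N.
Proof.
move=> [f [_ fE]]; rewrite fE; case: l f fE => [|[|l]] f _ //.
  by case: (f u).
by rewrite !ord1.
Qed.

Lemma is_cycle3 u v w : adj u v -> adj v w -> adj w u ->
  is_cycle adj [:: u; v; w].
Proof.
move=> uv vw wu; rewrite /is_cycle /ucycleb /= uv vw wu /= !inE.
apply/andP; split=> //; rewrite negb_or andbT -andbA.
by apply/and3P; split; apply/eqP => e; move: uv vw wu; rewrite e ?adjI.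
Qed.

Lemma is_cycle4 a b c d : adj a b -> adj b c -> adj c d -> adj d a ->
  a != c -> b != d -> is_cycle adj [:: a; b; c; d].
Proof.
move=> ab bc cd da ac bd; rewrite /is_cycle /ucycleb /= ab bc cd da /= !inE.
rewrite !negb_or ac bd !andbT -andbA.
by apply/and4P; split; apply/eqP => e; move: ab bc cd da; rewrite e ?adjI.
Qed.

Lemma bipartite_cycle_size c : complete_multipartite adj 2 -> is_cycle adj c ->
  (4 <= size c)%N.
Proof.
move=> [f [_ fE]]; rewrite /is_cycle /ucycleb.
case: c => [|u [|v [|w [|z c]]]] //; rewrite ?andbF //= !fE.
by move: (f u) (f v) (f w) => [[|[|?]] ?] [[|[|?]] ?] [[|[|?]] ?].
Qed.

(** [theta] makes all edges at [a] and at [b] positive; any other edge lies on a 4-cycle through [a]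
    and [b], which determines its sign. *)
Lemma bipartite_switching (a b : 'I_n) : complete_multipartite adj 2 -> adj a b ->
  (forall c, is_cycle adj c -> size c = 4 -> ~~ cycle_negative sigma c) ->
  switching_equiv adj sigma (fun _ _ => false).
Proof.
move=> [f [_ fE]] ab pos.
pose theta v := if f v == f a then sigma v b (+) sigma a b else sigma a v.
have two (i j k : 'I_2) : i != j -> k != j -> k = i.
  by move: i j k => [[|[|?]] ?] [[|[|?]] ?] [[|[|?]] ?] //= *; apply/val_inj.
have key u v : f u = f a -> f v != f a ->
    sigma u v = sigma u b (+) sigma a b (+) sigma a v.
  move=> fu fv; have fb : f b != f a by move: ab; rewrite fE eq_sym.
  have [->|ua] := eqVneq u a; first by rewrite addbb.
  have [->|vb] := eqVneq v b; first by rewrite addbK.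
  have cyc : is_cycle adj [:: a; v; u; b].
    apply: is_cycle4; rewrite ?fE //; try by rewrite eq_sym.
    - by rewrite fu.
    - by rewrite fu eq_sym.
  have := pos _ cyc erefl; rewrite /cycle_negative /= addn0 !oddD !oddb.
  rewrite (sigmaC b a) (sigmaC v u).
  by case: (sigma a v); case: (sigma u v); case: (sigma u b); case: (sigma a b).
exists theta => u v; rewrite fE => fuv; rewrite /theta.
case: eqP => [fu|/eqP fu]; case: eqP => [fv|/eqP fv].
- by rewrite fu fv eqxx in fuv.
- by rewrite (key u v) // -!addbA; do 3!case: (sigma _ _).
- by rewrite sigmaC (key v u) // -!addbA; do 3!case: (sigma _ _).
- by case/eqP: fuv; rewrite (two _ _ _ fv fu).
Qed.

Lemma negative_triangles_switching l : complete_multipartite adj l ->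
  (3 <= l)%N ->
  (forall c, is_cycle adj c -> size c = 3 -> cycle_negative sigma c) ->
  switching_equiv adj sigma (fun _ _ => true).
Proof.
move=> [f [fsurj fE]] l3 neg.
have T u v w : f u != f v -> f v != f w -> f u != f w ->
    sigma u v (+) sigma v w (+) sigma u w.
  move=> uv vw uw.
  have cyc : is_cycle adj [:: u; v; w].
    by apply: is_cycle3; rewrite fE // eq_sym.
  have := neg _ cyc erefl.
  by rewrite /cycle_negative /= addn0 !oddD !oddb (sigmaC w u) addbA.
have [a fa] := fsurj (Ordinal (ltn_trans (isT : 0 < 2)%N l3)).
have [b fb] := fsurj (Ordinal (ltn_trans (isT : 1 < 2)%N l3)).
have [d fd] := fsurj (Ordinal l3).
have ab : f a != f b by rewrite fa fb.
have ad : f a != f d by rewrite fa fd.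
have bd : f b != f d by rewrite fb fd.
(* This choice makes negative all edges at [a] and all edges from the part of [a] to [b]; triangles
   settle the remaining edges. *)
pose theta v := if f v == f a then sigma v b (+) sigma a b else ~~ sigma a v.
have k1 u v : f u = f a -> f v != f a -> f v != f b ->
    sigma u v = sigma u b (+) sigma a b (+) sigma a v.
  move=> fu va vb.
  have := T u b v; have := T a b v; rewrite fu ab (eq_sym _ (f v)) vb eq_sym va.
  move=> /(_ isT isT isT) + /(_ isT isT isT).
  by do 5!case: (sigma _ _).
(* For [v] in the part of [b] no triangle contains both, so the sign is transported through [d] in a
   third part. *)
have k2 u v : f u = f a -> f v != f a ->
    sigma u v = sigma u b (+) sigma a b (+) sigma a v.
  move=> fu va; have [vb|vb] := eqVneq (f v) (f b); last exact: k1.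
  have ud : sigma u d = sigma u b (+) sigma a b (+) sigma a d.
    by apply: k1; rewrite // eq_sym.
  have := T u d v; have := T a d v.
  rewrite fu vb ab ad (eq_sym (f d)) bd ud => /(_ isT isT isT) + /(_ isT isT isT).
  by do 6!case: (sigma _ _).
exists theta => u v; rewrite fE => fuv; rewrite /theta.
case: eqP => [fu|/eqP fu]; case: eqP => [fv|/eqP fv].
- by rewrite fu fv eqxx in fuv.
- by rewrite (k2 u v) //; do 3!case: (sigma _ _).
- by rewrite sigmaC (k2 v u) //; do 3!case: (sigma _ _).
- have := T a u v; rewrite eq_sym fu fuv eq_sym fv => /(_ isT isT isT).
  by do 3!case: (sigma _ _).
Qed.

Lemma switching_negative_neg_index l : complete_multipartite adj l ->
  switching_equiv adj sigma (fun _ _ => true) -> (neg_index A <= 1)%N.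
Proof.
move=> [f [_ fE]] [theta sw].
apply: (neg_index_multipartite (f := f) (t := fun u => (-1) ^+ theta u)) => [u|u v].
  by rewrite realX // realN real1.
rewrite sadj_mxE fE; case: eqP => [_|/eqP fuv]; first by rewrite mul0r.
have := sw u v; rewrite fE fuv => /(_ isT) e.
rewrite mul1r -signr_addb -[RHS]mulN1r -[-1]/((-1) ^+ true) -signr_addb.
by congr (_ ^+ _); case: (sigma u v) (theta u) (theta v) e => [] [] [].
Qed.

(** Switching one whole side reverses every edge, so the bipartite case reduces to the all-negative
    signature. *)
Lemma bipartite_switching_negative : complete_multipartite adj 2 ->
  switching_equiv adj sigma (fun _ _ => false) ->
  switching_equiv adj sigma (fun _ _ => true).
Proof.
move=> [f [_ fE]] [theta sw]; exists (fun u => theta u (+) (f u == ord0)) => u v uv.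
have := sw _ _ uv; move: uv; rewrite fE.
by move: (f u) (f v) => [[|[|?]] ?] [[|[|?]] ?] //= _;
  case: (sigma _ _); case: (theta u); case: (theta v).
Qed.

Lemma shortest_cycle_spanning c : connected_graph adj -> shortest_cycle adj c ->
  (5 <= size c)%N -> (neg_index A < uphalf (size c))%N -> forall x, x \in c.
Proof.
move=> conn sc c5 neg x; apply: contraLR neg => xc; rewrite -leqNgt.
have [w wc [v vc wv]] : exists2 w, w \notin c & exists2 v, v \in c & adj w v.
  have [v vc] : exists v, v \in c by case: (c) c5 => // v ? _; exists v; rewrite mem_head.
  case: (boolP [exists w, (w \notin c) && [exists v, (v \in c) && adj w v]]).
    by case/existsP => w /andP[wc /existsP[y /andP[yc wy]]]; exists w => //; exists y.
  rewrite negb_exists => /forallP none.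
  (* If no edge left [c], its vertex set would be a union of components, against connectedness. *)
  suff cl : closed adj (mem c).
    by have := closed_connect cl (conn x v); rewrite /= (negPf xc) vc.
  apply: intro_closed => [|y z yz yc]; first exact: sym_connect_sym.
  have := none z; rewrite negb_and negbK => /orP[//|].
  by rewrite negb_exists => /forallP/(_ y); rewrite adjC yz andbT => /negP[].
(* Rotation brings the attachment vertex [v] to position [0]. *)
have sc' := shortest_cycle_rot (index v c) sc.
have := pendant_neg_index adjC adjI sigmaC sc' _ (w := w); rewrite size_rot mem_rot.
apply=> //; rewrite /rot nth_cat size_drop subn_gt0 index_mem vc nth_drop addn0.
by rewrite nth_index.
Qed.

End Multipartite.

Local Close Scope sesquilinear_scope.
Local Close Scope ring_scope.

Theorem theorem3p1 (n : nat) (adj : rel 'I_n) (sigma : 'I_n -> 'I_n -> bool)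
  (g : nat) (c : seq 'I_n) :
  symmetric adj -> irreflexive adj ->
  (forall u v, sigma u v = sigma v u) ->
  connected_graph adj ->
  is_girth adj g ->
  is_cycle adj c -> size c = g ->
  ((uphalf g).-1 <= neg_index (sadj_mx adj sigma))%N /\
  (neg_index (sadj_mx adj sigma) = (uphalf g).-1 <->
    (graph_is_cycle adj c /\
       ((~~ cycle_negative sigma c /\ (g %% 4 == 0 \/ g %% 4 == 1)%N) \/
        (cycle_negative sigma c /\ (g %% 4 == 2 \/ g %% 4 == 3)%N)))
    \/
    ((complete_multipartite adj 2 /\ switching_equiv adj sigma (fun _ _ => false))
     \/
     (exists l, (3 <= l)%N /\ complete_multipartite adj l /\
        (forall c3, is_cycle adj c3 -> size c3 = 3 -> cycle_negative sigma c3)))).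
Proof.
move=> adjC adjI sigmaC conn [_ min] cyc cg; subst g.
have sc : shortest_cycle adj c by [].
have c3 : (3 <= size c)%N by case/andP: cyc.
have lower := shortest_cycle_neg_index adjC adjI sigmaC sc.
split=> //; split=> [eqn|].
  (* Equality constrains the sign of every shortest cycle, not just [c]; for girth 3 or 4 this
     reaches all triangles or all 4-cycles. *)
  have bad c' : shortest_cycle adj c' -> size c' = size c -> good_sign sigma c'.
    move=> sc' s'; apply/negPn/negP => /(bad_sign_neg_index adjC adjI sigmaC sc').
    by rewrite s' eqn; lia.
  have [c5|c4] := leqP 5 (size c).
    left; have all_c : forall x, x \in c.
      by apply: (shortest_cycle_spanning adjC adjI sigmaC conn sc c5); rewrite eqn; lia.
    split; first exact: graph_is_cycle_shortest.
    have := bad _ sc erefl; rewrite /good_sign => /eqP.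
    by case: (cycle_negative _ _) => e; [right|left]; split=> //; apply/orP; lia.
  right; have n1 : (neg_index (sadj_mx adj sigma) <= 1)%N by rewrite eqn; lia.
  have [a [b ab]] : exists a b, adj a b.
    case: (c) c3 cyc => [|a [|b p]] // _ /andP[/andP[/= /andP[ab _] _] _].
    by exists a, b.
  have [l ml] := complete_multipartiteP adjC adjI a
    (fun u v w => @neg_index1_adj _ _ _ adjC adjI sigmaC u v w conn n1).
  have := complete_multipartite_ge2 ml ab.
  rewrite leq_eqVlt => /orP[/eqP l2|l3].
    subst l; left; split=> //; apply: (bipartite_switching adjI sigmaC ml ab).
    (* Two parts exclude triangles, so the girth is 4 and every 4-cycle is shortest; its good sign
       is positive. *)
    move=> c' cyc' s'; have := bipartite_cycle_size ml cyc => ge4.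
    have sc' : shortest_cycle adj c'.
      by split=> // c''; rewrite s'; apply: bipartite_cycle_size.
    by have := bad _ sc'; rewrite /good_sign s' => /(_ _)/eqP->; lia.
  right; exists l; split=> //; split=> // c' cyc' s'.
  (* Any triangle forces girth 3 and is itself a shortest cycle; its good sign is negative. *)
  have le3 := min _ cyc'; rewrite s' in le3.
  have sc' : shortest_cycle adj c'.
    by split=> // c''; rewrite s' => /andP[].
  by have := bad _ sc'; rewrite /good_sign s' => /(_ _)/eqP->; lia.
(* As [g >= 3], the lower bound is at least [1], so an upper bound of [1] already gives equality. *)
have small : (neg_index (sadj_mx adj sigma) <= 1)%N ->
    neg_index (sadj_mx adj sigma) = (uphalf (size c)).-1 by lia.
case=> [[[all_c _] sg]|[[m2 sw]|[l [l3 [ml neg3]]]]].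
- apply/eqP; rewrite eqn_leq lower andbT.
  apply: (good_sign_neg_index adjC adjI sigmaC sc) => //; rewrite /good_sign.
  by case: sg => -[+ /orP h]; case: (cycle_negative _ _) => //= _; lia.
- apply: small; apply: (switching_negative_neg_index m2).
  exact: bipartite_switching_negative.
apply: small; apply: (switching_negative_neg_index ml).
exact: (negative_triangles_switching adjI sigmaC ml).
Qed.
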